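(* Let $R$ be a commutative ring with unit, let $A$ be a symmetric nearly Frobenius $R$-algebra, let $B$ be a symmetric $R$-algebra, and let $\phi:A\twoheadrightarrow B$ be a surjective homomorphism of algebras, with Schur element $s_\phi\in B$. If $s_\phi$ is invertible in $B$, then $\phi$ splits as a morphism of $A$-bimodules.
   Context: A nearly Frobenius algebra is an associative unital $R$-algebra $A$ together with a homomorphism of $A$-bimodules $\Delta: A\to A\otimes_R A$, where $a\cdot(x\otimes y)\cdot b=ax\otimes yb$. It is symmetric if $\Delta(1_A)=\tau(\Delta(1_A))$, where $\tau(x\otimes y)=y\otimes x$. An associative unital $R$-algebra $B$ is Frobenius if it is finitely generated and projective as an $R$-module and is equipped with an isomorphism of left $B$-modules $\lambda_l:B\to B^*=\mathrm{Hom}_R(B,R)$, where $(a\cdot f)(b)=f(ba)$; its trace is $\varepsilon_B=\lambda_l(1_B):B\to R$. A symmetric algebra is a Frobenius algebra with $\varepsilon_B(ab)=\varepsilon_B(ba)$ for all $a,b\in B$. For $A$ nearly Frobenius, $B$ Frobenius and $\phi:A\to B$ a surjective algebra homomorphism, write $\Delta(1_A)=\sum_i e^i\otimes e_i$ (not necessarily dual bases); the Schur element of $\phi$ is $s_\phi=\sum_i\varepsilon_B(\phi(e^i))\,\phi(e_i)\in B$. $B$ is an $A$-bimodule via $a\cdot b\cdot a'=\phi(a)b\phi(a')$. *)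

(* Defs.v *)
From HB Require Import structures.
From mathcomp Require Import all_boot all_order all_algebra.
From mathcomp Require Import boolp.

Set Implicit Arguments.
Unset Strict Implicit.
Unset Printing Implicit Defensive.

Import GRing.Theory.
Local Open Scope ring_scope.

(* MathComp's [{bilinear _ -> _ -> _}] excludes the zero base ring. *)
Definition bilinear_map (R : comPzRingType) (M N L : lmodType R)
    (f : M -> N -> L) : Prop :=
  (forall y, linear (f^~ y)) /\ (forall x, linear (f x)).

Lemma bilinear_map0l (R : comPzRingType) (M N L : lmodType R)
    (f : M -> N -> L) (fB : bilinear_map f) y : f 0 y = 0.
Proof. by have := fB.1 y (-1) 0 0; rewrite scaler0 add0r scaleN1r addNr. Qed.

Lemma bilinear_mapDl (R : comPzRingType) (M N L : lmodType R)
    (f : M -> N -> L) (fB : bilinear_map f) x x' y : f (x + x') y = f x y + f x' y.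
Proof. by have := fB.1 y 1 x x'; rewrite /= !scale1r. Qed.

Lemma bilinear_mapZl (R : comPzRingType) (M N L : lmodType R)
    (f : M -> N -> L) (fB : bilinear_map f) a x y : f (a *: x) y = a *: f x y.
Proof. by have := fB.1 y a x 0; rewrite /= !addr0 (bilinear_map0l fB) addr0. Qed.

Lemma bilinear_map0r (R : comPzRingType) (M N L : lmodType R)
    (f : M -> N -> L) (fB : bilinear_map f) x : f x 0 = 0.
Proof. by have := fB.2 x (-1) 0 0; rewrite scaler0 add0r scaleN1r addNr. Qed.

Lemma bilinear_mapDr (R : comPzRingType) (M N L : lmodType R)
    (f : M -> N -> L) (fB : bilinear_map f) x y y' : f x (y + y') = f x y + f x y'.
Proof. by have := fB.2 x 1 y y'; rewrite !scale1r. Qed.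

Lemma bilinear_mapZr (R : comPzRingType) (M N L : lmodType R)
    (f : M -> N -> L) (fB : bilinear_map f) a x y : f x (a *: y) = a *: f x y.
Proof. by have := fB.2 x a y 0; rewrite !addr0 (bilinear_map0r fB) addr0. Qed.

(* Associative unital R-algebras.  MathComp's [algType R] imposes 1 != 0; here
   R and the algebra may be zero.  A type [A : pzAlgType R] has both a
   [pzRingType] and an [lmodType R] structure, and [pzAlg_of_algType] embeds the
   MathComp algebras. *)
Record pzAlgType (R : comPzRingType) := PzAlgType {
  pzalg_mod : lmodType R;
  pzalg_one : pzalg_mod;
  pzalg_mul : pzalg_mod -> pzalg_mod -> pzalg_mod;
  pzalg_mulA : associative pzalg_mul;
  pzalg_mul1 : left_id pzalg_one pzalg_mul;
  pzalg_mulr1 : right_id pzalg_one pzalg_mul;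
  pzalg_mul_bilin : bilinear_map pzalg_mul
}.

(* A constant distinct from the projection, so that it can carry ring and module
   instances without interfering with MathComp's hierarchy. *)
Definition pzalg_sort (R : comPzRingType) (A : pzAlgType R) : Type := pzalg_mod A.
Coercion pzalg_sort : pzAlgType >-> Sortclass.

Section PzAlgInstances.

Variables (R : comPzRingType) (A : pzAlgType R).

HB.instance Definition _ := GRing.Lmodule.copy (pzalg_sort A) (pzalg_mod A).

Lemma pzalg_mulDl : left_distributive (@pzalg_mul R A) +%R.
Proof. by move=> x y z; apply: (bilinear_mapDl (pzalg_mul_bilin A)). Qed.

Lemma pzalg_mulDr : right_distributive (@pzalg_mul R A) +%R.
Proof. by move=> x y z; apply: (bilinear_mapDr (pzalg_mul_bilin A)). Qed.

HB.instance Definition _ := GRing.Zmodule_isPzRing.Build (pzalg_sort A)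
  (@pzalg_mulA R A) (@pzalg_mul1 R A) (@pzalg_mulr1 R A) pzalg_mulDl pzalg_mulDr.

Lemma pzscalerAl (a : R) (x y : A) : a *: (x * y) = (a *: x) * y.
Proof. by apply/esym; apply: (bilinear_mapZl (pzalg_mul_bilin A)). Qed.

Lemma pzscalerAr (a : R) (x y : A) : a *: (x * y) = x * (a *: y).
Proof. by apply/esym; apply: (bilinear_mapZr (pzalg_mul_bilin A)). Qed.

End PzAlgInstances.

Lemma algType_mul_bilin (R : comPzRingType) (A : algType R) :
  bilinear_map (fun x y : A => x * y).
Proof.
split=> [y a x x' | x a y y'] /=; first by rewrite mulrDl scalerAl.
by rewrite mulrDr scalerAr.
Qed.

Definition pzAlg_of_algType (R : comPzRingType) (A : algType R) : pzAlgType R :=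
  PzAlgType (@mulrA A) (@mul1r A) (@mulr1 A) (@algType_mul_bilin R A).

(* The tensor product over R of two R-modules: formal sums of pairs, modulo the
   least additive congruence making the pairing R-bilinear.  The list
   [:: (x1, y1); ...; (xn, yn)] stands for the sum of the x_i (x) y_i. *)
Section Tensor.

Variables (R : comPzRingType) (M N : lmodType R).

Inductive tensor_cong : seq (M * N) -> seq (M * N) -> Prop :=
| tc_refl s : tensor_cong s s
| tc_sym s t : tensor_cong s t -> tensor_cong t s
| tc_trans s t u : tensor_cong s t -> tensor_cong t u -> tensor_cong s u
| tc_cat s s' t t' :
    tensor_cong s s' -> tensor_cong t t' -> tensor_cong (s ++ t) (s' ++ t')
| tc_comm s t : tensor_cong (s ++ t) (t ++ s)
| tc_zero y : tensor_cong [:: (0, y)] [::]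
| tc_addl x x' y : tensor_cong [:: (x + x', y)] [:: (x, y); (x', y)]
| tc_addr x y y' : tensor_cong [:: (x, y + y')] [:: (x, y); (x, y')]
| tc_scale r x y : tensor_cong [:: (r *: x, y)] [:: (x, r *: y)].

Definition tensor_congb : rel (seq (M * N)) := fun s t => `[< tensor_cong s t >].

Lemma tensor_congb_refl : reflexive tensor_congb.
Proof. by move=> s; apply/asboolP/tc_refl. Qed.

Lemma tensor_congb_sym : symmetric tensor_congb.
Proof. by move=> s t; apply/asboolP/asboolP => /tc_sym. Qed.

Lemma tensor_congb_trans : transitive tensor_congb.
Proof.
by move=> t s u /asboolP st /asboolP tu; apply/asboolP/(tc_trans st tu).
Qed.

Canonical tensor_equiv :=
  EquivRel tensor_congb tensor_congb_refl tensor_congb_sym tensor_congb_trans.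

Definition tensor : Type := {eq_quot tensor_equiv}%qT.

HB.instance Definition _ := Choice.on tensor.

Definition tensor_class (s : seq (M * N)) : tensor := (\pi_{eq_quot tensor_equiv} s)%qT.
Definition tensor_repr (t : tensor) : seq (M * N) :=
  repr (t : {eq_quot tensor_equiv}%qT).

Lemma tensor_reprK : cancel tensor_repr tensor_class.
Proof. by move=> t; apply: reprK. Qed.

Lemma tensor_classP s t : tensor_class s = tensor_class t <-> tensor_cong s t.
Proof.
split=> [st|st]; first by apply/asboolP; apply/(@eqmodP _ tensor_equiv).
by apply/(@eqmodP _ tensor_equiv)/asboolP.
Qed.

Lemma tensor_repr_class s : tensor_cong (tensor_repr (tensor_class s)) s.
Proof. by apply/tensor_classP; rewrite tensor_reprK. Qed.

Definition tensor_zero : tensor := tensor_class [::].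
Definition tensor_add (s t : tensor) : tensor :=
  tensor_class (tensor_repr s ++ tensor_repr t).
Definition tensor_scale (r : R) (t : tensor) : tensor :=
  tensor_class [seq (r *: p.1, p.2) | p <- tensor_repr t].
Definition tensor_opp (t : tensor) : tensor := tensor_scale (-1) t.

Lemma tensor_class_cat s t :
  tensor_class (s ++ t) = tensor_add (tensor_class s) (tensor_class t).
Proof.
by apply/tensor_classP/tc_sym; apply: tc_cat; apply: tensor_repr_class.
Qed.

Lemma tensor_cong_scale r s t : tensor_cong s t ->
  tensor_cong [seq (r *: p.1, p.2) | p <- s] [seq (r *: p.1, p.2) | p <- t].
Proof.
elim=> {s t} /=.
- by move=> s; apply: tc_refl.
- by move=> s t _; apply: tc_sym.
- by move=> s t u _ st _; apply: tc_trans st.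
- by move=> s s' t t' _ ss' _ tt'; rewrite !map_cat; apply: tc_cat.
- by move=> s t; rewrite !map_cat; apply: tc_comm.
- by move=> y; rewrite scaler0; apply: tc_zero.
- by move=> x x' y; rewrite scalerDr; apply: tc_addl.
- by move=> x y y'; apply: tc_addr.
- by move=> k x y; rewrite scalerA mulrC -scalerA; apply: tc_scale.
Qed.

Lemma tensor_class_scale r s :
  tensor_class [seq (r *: p.1, p.2) | p <- s] = tensor_scale r (tensor_class s).
Proof.
by apply/tensor_classP/tensor_cong_scale/tc_sym/tensor_repr_class.
Qed.

Lemma tensor_ind (P : tensor -> Prop) :
  (forall s, P (tensor_class s)) -> forall t, P t.
Proof. by move=> H t; rewrite -[t]tensor_reprK. Qed.

Lemma tensor_addA : associative tensor_add.
Proof.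
elim/tensor_ind=> s; elim/tensor_ind=> t; elim/tensor_ind=> u.
by rewrite -!tensor_class_cat catA.
Qed.

Lemma tensor_addC : commutative tensor_add.
Proof.
elim/tensor_ind=> s; elim/tensor_ind=> t.
by rewrite -!tensor_class_cat; apply/tensor_classP/tc_comm.
Qed.

Lemma tensor_add0 : left_id tensor_zero tensor_add.
Proof. by elim/tensor_ind=> s; rewrite -tensor_class_cat. Qed.

Lemma tensor_scale0 t : tensor_scale 0 t = tensor_zero.
Proof.
elim/tensor_ind: t => s; rewrite -tensor_class_scale; apply/tensor_classP.
elim: s => [|[x y] s IHs] /=; first exact: tc_refl.
rewrite scale0r -cat1s -[X in tensor_cong _ X]cat0s.
exact: tc_cat (tc_zero y) IHs.
Qed.

Lemma tensor_scaleDl t :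
  {morph tensor_scale^~ t : a b / a + b >-> tensor_add a b}.
Proof.
move=> a b; elim/tensor_ind: t => s.
rewrite -!tensor_class_scale -tensor_class_cat; apply/tensor_classP.
elim: s => [|[x y] s IHs] /=; first exact: tc_refl.
rewrite scalerDl -cat1s.
apply: tc_trans (tc_cat (tc_addl _ _ _) IHs) _ => /=.
rewrite -cat1s -[X in tensor_cong _ X]cat1s.
apply: tc_cat; first exact: tc_refl.
rewrite -cat1s catA -[X in tensor_cong _ (_ ++ X)]cat1s catA.
by apply: tc_cat; [apply: tc_comm | apply: tc_refl].
Qed.

Lemma tensor_scale1 : left_id 1 tensor_scale.
Proof.
elim/tensor_ind=> s; rewrite -tensor_class_scale; congr tensor_class.
by elim: s => [|[x y] s IHs] //=; rewrite scale1r IHs.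
Qed.

Lemma tensor_addN : left_inverse tensor_zero tensor_opp tensor_add.
Proof.
move=> t; rewrite /tensor_opp -{2}[t]tensor_scale1 -tensor_scaleDl addNr.
exact: tensor_scale0.
Qed.

HB.instance Definition _ :=
  GRing.isZmodule.Build tensor tensor_addA tensor_addC tensor_add0 tensor_addN.

Lemma tensor_scaleA a b t :
  tensor_scale a (tensor_scale b t) = tensor_scale (a * b) t.
Proof.
elim/tensor_ind: t => s; rewrite -!tensor_class_scale; congr tensor_class.
by elim: s => [|[x y] s IHs] //=; rewrite scalerA IHs.
Qed.

Lemma tensor_scaleDr : right_distributive tensor_scale +%R.
Proof.
move=> a; elim/tensor_ind=> s; elim/tensor_ind=> t.
by rewrite -[LHS]/(tensor_scale a (tensor_add _ _)) -tensor_class_cat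
  -!tensor_class_scale map_cat tensor_class_cat.
Qed.

HB.instance Definition _ := GRing.Zmodule_isLmodule.Build R tensor
  tensor_scaleA tensor_scale1 tensor_scaleDr tensor_scaleDl.

Definition tens (x : M) (y : N) : tensor := tensor_class [:: (x, y)].

Lemma tens_bilinear : bilinear_map tens.
Proof.
split=> [y a x x' | x a y y'].
  rewrite -[RHS]/(tensor_add (tensor_scale a (tens x y)) (tens x' y)).
  rewrite -tensor_class_scale -tensor_class_cat /=.
  exact/tensor_classP/tc_addl.
rewrite -[RHS]/(tensor_add (tensor_scale a (tens x y)) (tens x y')).
rewrite -tensor_class_scale -tensor_class_cat /=.
apply/tensor_classP; apply: tc_trans (tc_addr _ _ _) _.
rewrite -cat1s -[X in tensor_cong _ X]cat1s.
by apply: tc_cat; [apply/tc_sym/tc_scale | apply: tc_refl].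
Qed.

Lemma tensor_class_sum s : tensor_class s = \sum_(p <- s) tens p.1 p.2.
Proof.
elim: s => [|[x y] s IHs]; first by rewrite big_nil.
by rewrite big_cons -IHs -cat1s tensor_class_cat.
Qed.

Lemma tensorP (t : tensor) :
  exists (n : nat) (e : 'I_n -> M) (f : 'I_n -> N),
    t = \sum_(i < n) tens (e i) (f i).
Proof.
exists (size (tensor_repr t)).
exists (fun i => (nth (0, 0) (tensor_repr t) i).1).
exists (fun i => (nth (0, 0) (tensor_repr t) i).2).
by rewrite -{1}[t]tensor_reprK tensor_class_sum (big_nth (0, 0)) big_mkord.
Qed.

(* [tens_eval f t] is the sum of the f x_i y_i, for a chosen expression of t as
   a sum of pure tensors x_i (x) y_i; [tens_eval_sum] shows that the choice is
   irrelevant as soon as f is bilinear, so that [tens_eval f] is then the linear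
   map induced by f. *)
Definition tens_eval (L : lmodType R) (f : M -> N -> L) (t : tensor) : L :=
  \sum_(p <- tensor_repr t) f p.1 p.2.

Section Eval.

Variables (L : lmodType R) (f : M -> N -> L).
Hypothesis f_bilin : bilinear_map f.

Lemma tensor_cong_eval s t : tensor_cong s t ->
  \sum_(p <- s) f p.1 p.2 = \sum_(p <- t) f p.1 p.2.
Proof.
elim=> {s t} //.
- by move=> s t u _ -> _ ->.
- by move=> s s' t t' _ ss' _ tt'; rewrite !big_cat ss' tt'.
- by move=> s t; rewrite !big_cat /= addrC.
- by move=> y; rewrite big_seq1 big_nil (bilinear_map0l f_bilin).
- by move=> x x' y; rewrite !big_cons !big_nil !addr0 (bilinear_mapDl f_bilin).
- by move=> x y y'; rewrite !big_cons !big_nil !addr0 (bilinear_mapDr f_bilin).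
- by move=> r x y; rewrite !big_seq1 (bilinear_mapZl f_bilin) (bilinear_mapZr f_bilin).
Qed.

Lemma tens_eval_class s : tens_eval f (tensor_class s) = \sum_(p <- s) f p.1 p.2.
Proof. exact/tensor_cong_eval/tensor_repr_class. Qed.

Lemma tens_eval_linear : linear (tens_eval f).
Proof.
move=> a; elim/tensor_ind=> s; elim/tensor_ind=> t.
rewrite -[a *: _ + _]/(tensor_add (tensor_scale a (tensor_class s)) (tensor_class t)).
rewrite -tensor_class_scale -tensor_class_cat !tens_eval_class big_cat /=.
congr (_ + _); rewrite big_map scaler_sumr.
by apply: eq_bigr => p _; apply: (bilinear_mapZl f_bilin).
Qed.

Lemma tens_evalE x y : tens_eval f (tens x y) = f x y.
Proof. by rewrite tens_eval_class big_seq1. Qed.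

Lemma tens_eval_sum n (e : 'I_n -> M) (g : 'I_n -> N) :
  tens_eval f (\sum_(i < n) tens (e i) (g i)) = \sum_(i < n) f (e i) (g i).
Proof.
have -> : \sum_(i < n) tens (e i) (g i)
    = tensor_class [seq (e i, g i) | i <- enum 'I_n].
  by rewrite tensor_class_sum big_map big_enum.
by rewrite tens_eval_class big_map big_enum.
Qed.

End Eval.

End Tensor.

Arguments tens {R M N} x y.

(* A bimodule over A is given by its left and right actions. *)
Definition bimodule_morphism (R : comPzRingType) (A : pzAlgType R)
    (U V : lmodType R) (lU : A -> U -> U) (rU : U -> A -> U)
    (lV : A -> V -> V) (rV : V -> A -> V) (f : {linear U -> V}) : Prop :=
  (forall a u, f (lU a u) = lV a (f u)) /\
  (forall u a, f (rU u a) = rV (f u) a).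

Section NearlyFrobenius.

Variables (R : comPzRingType) (A : pzAlgType R).

Definition tens_lact (a : A) (t : tensor A A) : tensor A A :=
  tens_eval (fun x y : A => tens (a * x) y) t.

Definition tens_ract (t : tensor A A) (b : A) : tensor A A :=
  tens_eval (fun x y : A => tens x (y * b)) t.

Definition tens_swap (t : tensor A A) : tensor A A :=
  tens_eval (fun x y : A => tens y x) t.

Lemma tens_lactE a x y : tens_lact a (tens x y) = tens (a * x) y.
Proof.
have [tl tr] := @tens_bilinear R A A.
apply: tens_evalE; split=> [z c u v | u c z w]; last exact: tr.
by rewrite -[LHS]/(tens (a * (c *: u + v)) z) mulrDr -pzscalerAr; apply: tl.
Qed.

Lemma tens_ractE x y b : tens_ract (tens x y) b = tens x (y * b).
Proof.
have [tl tr] := @tens_bilinear R A A.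
apply: (tens_evalE (f := fun x y : A => tens x (y * b))).
split=> [z c u v | u c z w]; first exact: tl.
by rewrite mulrDl -pzscalerAl; apply: tr.
Qed.

Lemma tens_swapE x y : tens_swap (tens x y) = tens y x.
Proof.
have [tl tr] := @tens_bilinear R A A.
apply: (tens_evalE (f := fun x y : A => tens y x)).
by split=> [z c u v | u c z w]; [apply: tr | apply: tl].
Qed.

Record nearlyFrobenius := NearlyFrobenius {
  nF_coprod :> {linear A -> tensor A A};
  nF_coprod_bimod :
    bimodule_morphism (fun a x : A => a * x) (fun x a : A => x * a)
      tens_lact tens_ract nF_coprod
}.

Definition symmetric_nearlyFrobenius (Delta : nearlyFrobenius) : Prop :=
  Delta 1 = tens_swap (Delta 1).

End NearlyFrobenius.

Section Frobenius.

Definition finitely_generated (R : comPzRingType) (M : lmodType R) : Prop :=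
  exists (n : nat) (g : 'I_n -> M),
    forall m, exists c : 'I_n -> R, m = \sum_(i < n) c i *: g i.

Definition projective (R : comPzRingType) (M : lmodType R) : Prop :=
  forall (U V : lmodType R) (p : {linear U -> V}) (f : {linear M -> V}),
    (forall v, exists u, p u = v) ->
    exists h : {linear M -> U}, forall m, p (h m) = f m.

Variables (R : comPzRingType) (B : pzAlgType R).

(* The dual of B is [{scalar B}], with pointwise addition and left action
   (a . f)(b) = f (b a). *)
Record frobenius := Frobenius {
  frob_fg : finitely_generated B;
  frob_proj : projective B;
  frob_lambda : B -> {scalar B};
  frob_lambdaD :
    forall a b x, frob_lambda (a + b) x = frob_lambda a x + frob_lambda b x;
  frob_lambdaM : forall a b x, frob_lambda (a * b) x = frob_lambda b (x * a);
  frob_lambda_bij : bijective frob_lambda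
}.

Definition frob_trace (F : frobenius) : {scalar B} := frob_lambda F 1.

Definition symmetric_frobenius (F : frobenius) : Prop :=
  forall a b, frob_trace F (a * b) = frob_trace F (b * a).

End Frobenius.

Section Schur.

Variables (R : comPzRingType) (A B : pzAlgType R).

Definition schur_element (Delta : nearlyFrobenius A) (F : frobenius B)
    (phi : {linear A -> B}) : B :=
  tens_eval (fun x y : A => frob_trace F (phi x) *: phi y) (Delta 1).

Lemma schur_element_bilinear (F : frobenius B) (phi : {linear A -> B}) :
  bilinear_map (fun x y : A => frob_trace F (phi x) *: phi y).
Proof.
split=> [y a x x' | x a y y'] /=.
  by rewrite !linearP /= scalerDl scalerA.
by rewrite linearP scalerDr !scalerA mulrC.
Qed.

Lemma schur_elementE (Delta : nearlyFrobenius A) (F : frobenius B)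
    (phi : {linear A -> B}) n (e f : 'I_n -> A) :
  Delta 1 = \sum_(i < n) tens (e i) (f i) ->
  schur_element Delta F phi = \sum_(i < n) frob_trace F (phi (e i)) *: phi (f i).
Proof.
by move=> D1; rewrite /schur_element D1 (tens_eval_sum (schur_element_bilinear _ _)).
Qed.

Definition splits_as_bimodule_morphism (phi : {linear A -> B}) : Prop :=
  exists sigma : {linear B -> A},
    bimodule_morphism (fun (a : A) (b : B) => phi a * b)
      (fun (b : B) (a : A) => b * phi a)
      (fun a x : A => a * x) (fun x a : A => x * a) sigma /\
    (forall b, phi (sigma b) = b).

End Schur.

Definition invertible (S : pzRingType) (s : S) : Prop :=
  exists t : S, s * t = 1 /\ t * s = 1.

(* Main.v *)
(* Write Delta 1 = sum_i e_i (x) f_i and let eps be the trace of B.  The map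
   theta b = sum_i eps (phi e_i * b) f_i is a bimodule morphism B -> A: on the
   right because a Delta(1) = Delta(1) a, on the left because of this and the
   symmetry of Delta 1.  Hence phi (theta b) = s b = b s with s the Schur
   element, which is therefore central, and b |-> theta (s^-1 b) is a section. *)
From HB Require Import structures.
Require Import Defs.
From mathcomp Require Import all_boot all_order all_algebra.
Local Open Scope ring_scope.
Import GRing.Theory.

Set Implicit Arguments.
Unset Strict Implicit.
Unset Printing Implicit Defensive.

Section Casimir.

Variables (R : comPzRingType) (A : pzAlgType R) (L : lmodType R).
Variables (Delta : nearlyFrobenius A) (n : nat) (e f : 'I_n -> A).
Hypothesis Delta1 : Delta 1 = \sum_(i < n) tens (e i) (f i).
Variable g : A -> A -> L.
Hypothesis g_bilin : bilinear_map g.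

(** With this and the next two lemmas, [tens_eval_sum] expands the two actions and the swap on the
    whole sum [Delta 1], not just on one pure tensor. *)
Lemma bilinear_tens_lact a : bilinear_map (fun x y : A => tens (a * x) y).
Proof.
have [tl tr] := @tens_bilinear R A A.
by split=> [z c u v | u c z w]; [rewrite mulrDr -pzscalerAr; apply: tl | apply: tr].
Qed.

Lemma bilinear_tens_ract a : bilinear_map (fun x y : A => tens x (y * a)).
Proof.
have [tl tr] := @tens_bilinear R A A.
by split=> [z c u v | u c z w]; [apply: tl | rewrite mulrDl -pzscalerAl; apply: tr].
Qed.

Lemma bilinear_tens_swap : bilinear_map (fun x y : A => tens y x).
Proof.
have [tl tr] := @tens_bilinear R A A.
by split=> [z c u v | u c z w]; [apply: tr | apply: tl].
Qed.

(** Both [a * 1] and [1 * a] are [a], so the left and right actions of [a] on [Delta 1] agree. The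
    linear map induced by [g] carries this equality of tensors to [L]. *)
Lemma casimir_sum a : \sum_i g (a * e i) (f i) = \sum_i g (e i) (f i * a).
Proof.
have [Dl Dr] := nF_coprod_bimod Delta.
have := Dl a 1; rewrite mulr1 -[X in Delta X]mul1r Dr Delta1 /tens_ract /tens_lact.
rewrite (tens_eval_sum (bilinear_tens_lact a)) (tens_eval_sum (bilinear_tens_ract a)).
by move/(congr1 (tens_eval g)); rewrite !(tens_eval_sum g_bilin).
Qed.

Lemma symmetric_sum : symmetric_nearlyFrobenius Delta ->
  \sum_i g (e i) (f i) = \sum_i g (f i) (e i).
Proof.
rewrite /symmetric_nearlyFrobenius Delta1 /tens_swap.
rewrite (tens_eval_sum bilinear_tens_swap).
by move/(congr1 (tens_eval g)); rewrite !(tens_eval_sum g_bilin).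
Qed.

End Casimir.

Section Transfer.

Variables (R : comPzRingType) (A B : pzAlgType R).
Variables (Delta : nearlyFrobenius A) (n : nat) (e f : 'I_n -> A).
Hypothesis Delta1 : Delta 1 = \sum_(i < n) tens (e i) (f i).
Hypothesis Delta_sym : symmetric_nearlyFrobenius Delta.
Variable F : frobenius B.
Hypothesis F_sym : symmetric_frobenius F.
Variable phi : {linear A -> B}.
Hypothesis phi_alg : GRing.monoid_morphism phi.

Definition transfer (b : B) : A :=
  \sum_(i < n) frob_trace F (phi (e i) * b) *: f i.

(** Presents [transfer b] as the image of [Delta 1] under a bilinear map, so that [casimir_sum] and
    [symmetric_sum] apply to it. *)
Lemma transfer_bilinear b :
  bilinear_map (fun x y : A => frob_trace F (phi x * b) *: y).
Proof.
split=> [y c x x' | x c y y'].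
  by rewrite linearP mulrDl -pzscalerAl linearP /= scalerDl scalerA.
by rewrite scalerDr !scalerA mulrC.
Qed.

Lemma transfer_linear : linear transfer.
Proof.
move=> c b b'; rewrite /transfer scaler_sumr -big_split /=.
apply: eq_bigr => i _.
by rewrite mulrDr -pzscalerAr linearP /= scalerDl scalerA.
Qed.

(** The Casimir identity turns [f i * a] into [a * e i] under the trace, and symmetry of the trace
    moves [phi a] cyclically to the right of [b]. *)
Lemma transferMr b a : transfer (b * phi a) = transfer b * a.
Proof.
rewrite /transfer mulr_suml.
under [RHS]eq_bigr => i _ do rewrite -pzscalerAl.
rewrite -(casimir_sum Delta1 (transfer_bilinear b)).
by apply: eq_bigr => i _; rewrite phi_alg.2 mulrA F_sym !mulrA.
Qed.

(** Here [a] sits on the inner side of each leg, as [e i * a] or [a * f i], while [casimir_sum]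
    handles the outer sides. Exchanging the legs by symmetry of [Delta 1] brings both sums into its
    form, with [gs] as the bilinear map. *)
Lemma transferMl a b : transfer (phi a * b) = a * transfer b.
Proof.
have [tl tr] := transfer_bilinear b.
have gr : bilinear_map (fun x y : A => frob_trace F (phi x * b) *: (a * y)).
  split=> [y c x x' | x c y y']; first exact: (tl (a * y)).
  by rewrite mulrDr -pzscalerAr; apply: tr.
have gl : bilinear_map (fun x y : A => frob_trace F (phi (x * a) * b) *: y).
  split=> [y c x x' | x c y y']; last exact: tr.
  by rewrite mulrDl -pzscalerAl; apply: tl.
have gs : bilinear_map (fun x y : A => frob_trace F (phi y * b) *: x).
  by split=> [y c x x' | x c y y']; [apply: tr | apply: tl].
rewrite /transfer mulr_sumr.
under [LHS]eq_bigr => i _ do rewrite mulrA -phi_alg.2.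
under [RHS]eq_bigr => i _ do rewrite -pzscalerAr.
rewrite (symmetric_sum Delta1 gl Delta_sym) (symmetric_sum Delta1 gr Delta_sym).
by rewrite (casimir_sum Delta1 gs).
Qed.

Lemma phi_transfer1 : phi (transfer 1) = schur_element Delta F phi.
Proof.
rewrite (schur_elementE F phi Delta1) /transfer linear_sum.
by apply: eq_bigr => i _; rewrite linearZ /= mulr1.
Qed.

End Transfer.

Theorem proposition4p13 (R : comPzRingType) (A B : pzAlgType R)
    (Delta : nearlyFrobenius A) (hA : symmetric_nearlyFrobenius Delta)
    (F : frobenius B) (hB : symmetric_frobenius F)
    (phi : {linear A -> B}) (phi_alg : GRing.monoid_morphism phi)
    (phi_surj : forall b : B, exists a : A, phi a = b) :
  invertible (schur_element Delta F phi) -> splits_as_bimodule_morphism phi.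
Proof.
have [n [e [f D1]]] := tensorP (Delta 1).
set s := schur_element _ _ _ => -[t [st ts]].
pose theta := transfer e f F phi.
have thetaMr b a : theta (b * phi a) = theta b * a by exact: (transferMr D1).
have thetaMl a b : theta (phi a * b) = a * theta b by exact: (transferMl D1).
have theta1 : phi (theta 1) = s by exact: (phi_transfer1 D1).
(* By surjectivity [b = phi a = 1 * phi a], and right linearity reduces to the value at 1. *)
have phi_theta b : phi (theta b) = s * b.
  by have [a <-] := phi_surj b; rewrite -[phi a]mul1r thetaMr phi_alg.2 theta1 mul1r.
(* The same computation with left linearity gives [phi (theta b) = b * s]; comparing the two makes
   [s] central. *)
have sC b : s * b = b * s.
  rewrite -phi_theta.
  by have [a <-] := phi_surj b; rewrite -[phi a]mulr1 thetaMl phi_alg.2 theta1 mulr1.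
(* [t b = t b s t = t s b t = b t]. *)
have tC b : t * b = b * t.
  by rewrite -[LHS]mulr1 -st mulrA -(mulrA t) -sC mulrA ts mul1r.
have sigma_linear : linear (fun b => theta (t * b)).
  by move=> c b b'; rewrite mulrDr -pzscalerAr; exact: transfer_linear.
pose sigmaL := GRing.isLinear.Build R B A *:%R (fun b => theta (t * b)) sigma_linear.
pose sigma : {linear B -> A} := HB.pack (fun b => theta (t * b)) sigmaL.
exists sigma; split; last by move=> b; rewrite /= phi_theta mulrA st mul1r.
split=> [a b | b a] /=; last by rewrite mulrA thetaMr.
(* Left linearity needs [t] to pass [phi a], hence the centrality of [t]. *)
by rewrite mulrA tC -mulrA thetaMl.
Qed.
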